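(* Let $(\mathbf C,\mathbf C_{\mathrm{free}})$ be a partitioned process theory and let $(X,\ge,\cdot)$ be a non-negative ordered monoid with unit $1$. A function $\mu:\mathrm{mor}(\mathbf C)\to X$ induces a (well-defined) order-preserving monoid homomorphism $$M:(\lvert\mathrm{PCD}(\mathbf C,\mathbf C_{\mathrm{free}})\rvert,\succeq,\otimes)\to(X,\ge,\cdot),\qquad [f]\mapsto\mu(f),$$ if and only if for all objects $Z$ of $\mathbf C$, all morphisms $f,g$ of $\mathbf C$ and all morphisms $\xi$ of $\mathbf C_{\mathrm{free}}$: (i) $\mu(f\otimes g)=\mu(f)\cdot\mu(g)$; (ii) $\mu(1_Z)=1$; (iii) $\mu(f)\ge\mu(\xi\circ f)$ and $\mu(f)\ge\mu(f\circ\xi)$ whenever these composites are defined. Moreover, this gives a one-to-one correspondence: every order-preserving monoid homomorphism from $(\lvert\mathrm{PCD}(\mathbf C,\mathbf C_{\mathrm{free}})\rvert,\succeq,\otimes)$ to $(X,\ge,\cdot)$ arises from a unique such function $\mu$.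
   Context: A partitioned process theory $(\mathbf C,\mathbf C_{\mathrm{free}})$ is a small symmetric monoidal category $\mathbf C$ (product $\otimes$) together with a symmetric monoidal subcategory $\mathbf C_{\mathrm{free}}$ containing all objects of $\mathbf C$; $\mathrm{mor}(\mathbf C)$ denotes the set of morphisms. For $f,g\in\mathrm{mor}(\mathbf C)$ write $f\succeq g$ if there exist an object $Z$ of $\mathbf C$, morphisms $\xi_1,\xi_2$ of $\mathbf C_{\mathrm{free}}$ and a morphism $j$ of $\mathbf C$ with $\xi_2\circ(f\otimes 1_Z)\circ\xi_1=g\otimes j$. This is a preorder compatible with $\otimes$ (existence of morphisms in the symmetric monoidal category $\mathrm{PCD}(\mathbf C,\mathbf C_{\mathrm{free}})$ of ''parallel-combinable processes with discarding''). Identifying $f,g$ when $f\succeq g$ and $g\succeq f$ gives the commutative ordered monoid $(\lvert\mathrm{PCD}(\mathbf C,\mathbf C_{\mathrm{free}})\rvert,\succeq,\otimes)$ of equivalence classes $[f]$, with $[f]\otimes[g]=[f\otimes g]$ and unit the class of the identity morphisms. An ordered monoid $(X,\ge,\cdot)$ is a set with a partial order and monoid multiplication such that $x\ge y$, $z\ge w$ imply $x\cdot z\ge y\cdot w$; it is non-negative if $x\ge 1$ for all $x\in X$. *)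

(* Defs.v *)
From HB Require Import structures.
From mathcomp Require Import all_boot all_order.
From mathcomp Require Import boolp.

Set Implicit Arguments.
Unset Strict Implicit.
Unset Printing Implicit Defensive.

Import Order.Theory.

Declare Scope smc_scope.
Delimit Scope smc_scope with smc.
Local Open Scope smc_scope.

Reserved Notation "g ∘ f" (at level 40, left associativity).
Reserved Notation "f ⊗ g" (at level 39, left associativity).
Reserved Notation "A ⊠ B" (at level 39, left associativity).

(* The monoidal structure is not assumed to be strict. [smc_tens] is the tensor
   product of objects (A ⊠ B), [smc_tensm] that of morphisms (f ⊗ g). *)
Record smc := Smc {
  smc_ob :> Type;
  smc_hom : smc_ob -> smc_ob -> Type;
  smc_id : forall A, smc_hom A A;
  smc_comp : forall A B C, smc_hom B C -> smc_hom A B -> smc_hom A C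
    where "g ∘ f" := (smc_comp g f);
  smc_compA : forall A B C D
    (h : smc_hom C D) (g : smc_hom B C) (f : smc_hom A B),
    h ∘ (g ∘ f) = (h ∘ g) ∘ f;
  smc_comp1f : forall A B (f : smc_hom A B), smc_id B ∘ f = f;
  smc_compf1 : forall A B (f : smc_hom A B), f ∘ smc_id A = f;

  smc_unit : smc_ob;
  smc_tens : smc_ob -> smc_ob -> smc_ob
    where "A ⊠ B" := (smc_tens A B);
  smc_tensm : forall A B C D,
    smc_hom A B -> smc_hom C D -> smc_hom (A ⊠ C) (B ⊠ D)
    where "f ⊗ g" := (smc_tensm f g);
  smc_tens1 : forall A B, smc_id A ⊗ smc_id B = smc_id (A ⊠ B);
  smc_tens_comp : forall A B C A' B' C'
    (g : smc_hom B C) (f : smc_hom A B)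
    (g' : smc_hom B' C') (f' : smc_hom A' B'),
    (g ∘ f) ⊗ (g' ∘ f') = (g ⊗ g') ∘ (f ⊗ f');

  smc_assoc : forall A B C, smc_hom ((A ⊠ B) ⊠ C) (A ⊠ (B ⊠ C));
  smc_assocV : forall A B C, smc_hom (A ⊠ (B ⊠ C)) ((A ⊠ B) ⊠ C);
  smc_assocK : forall A B C,
    smc_assocV A B C ∘ smc_assoc A B C = smc_id ((A ⊠ B) ⊠ C);
  smc_assocVK : forall A B C,
    smc_assoc A B C ∘ smc_assocV A B C = smc_id (A ⊠ (B ⊠ C));
  smc_assoc_nat : forall A B C A' B' C'
    (f : smc_hom A A') (g : smc_hom B B') (h : smc_hom C C'),
    smc_assoc A' B' C' ∘ ((f ⊗ g) ⊗ h) = (f ⊗ (g ⊗ h)) ∘ smc_assoc A B C;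

  smc_lunit : forall A, smc_hom (smc_unit ⊠ A) A;
  smc_lunitV : forall A, smc_hom A (smc_unit ⊠ A);
  smc_lunitK : forall A, smc_lunitV A ∘ smc_lunit A = smc_id (smc_unit ⊠ A);
  smc_lunitVK : forall A, smc_lunit A ∘ smc_lunitV A = smc_id A;
  smc_lunit_nat : forall A B (f : smc_hom A B),
    smc_lunit B ∘ (smc_id smc_unit ⊗ f) = f ∘ smc_lunit A;

  smc_runit : forall A, smc_hom (A ⊠ smc_unit) A;
  smc_runitV : forall A, smc_hom A (A ⊠ smc_unit);
  smc_runitK : forall A, smc_runitV A ∘ smc_runit A = smc_id (A ⊠ smc_unit);
  smc_runitVK : forall A, smc_runit A ∘ smc_runitV A = smc_id A;
  smc_runit_nat : forall A B (f : smc_hom A B),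
    smc_runit B ∘ (f ⊗ smc_id smc_unit) = f ∘ smc_runit A;

  smc_braid : forall A B, smc_hom (A ⊠ B) (B ⊠ A);
  smc_braidK : forall A B, smc_braid B A ∘ smc_braid A B = smc_id (A ⊠ B);
  smc_braid_nat : forall A B A' B' (f : smc_hom A A') (g : smc_hom B B'),
    smc_braid A' B' ∘ (f ⊗ g) = (g ⊗ f) ∘ smc_braid A B;

  smc_pentagon : forall A B C D,
    smc_assoc A B (C ⊠ D) ∘ smc_assoc (A ⊠ B) C D =
    (smc_id A ⊗ smc_assoc B C D) ∘ smc_assoc A (B ⊠ C) D
      ∘ (smc_assoc A B C ⊗ smc_id D);
  smc_triangle : forall A B,
    (smc_id A ⊗ smc_lunit B) ∘ smc_assoc A smc_unit B =
    smc_runit A ⊗ smc_id B;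
  smc_hexagon : forall A B C,
    smc_assoc B C A ∘ smc_braid A (B ⊠ C) ∘ smc_assoc A B C =
    (smc_id B ⊗ smc_braid A C) ∘ smc_assoc B A C
      ∘ (smc_braid A B ⊗ smc_id C)
}.

Arguments smc_hom {s} : rename.
Arguments smc_id {s} A : rename.
Arguments smc_comp {s A B C} : rename.
Arguments smc_unit {s} : rename.
Arguments smc_tens {s} : rename.
Arguments smc_tensm {s A B C D} : rename.
Arguments smc_assoc {s} A B C : rename.
Arguments smc_assocV {s} A B C : rename.
Arguments smc_lunit {s} A : rename.
Arguments smc_lunitV {s} A : rename.
Arguments smc_runit {s} A : rename.
Arguments smc_runitV {s} A : rename.
Arguments smc_braid {s} A B : rename.

Notation "g ∘ f" := (smc_comp g f) : smc_scope.
Notation "f ⊗ g" := (smc_tensm f g) : smc_scope.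
Notation "A ⊠ B" := (smc_tens A B) : smc_scope.

(* A subcategory containing all objects is given by its morphisms; being
   symmetric monoidal means that the coherence isomorphisms of C (and their
   inverses) lie in it. *)
Record is_wide_smsubcat (C : smc) (F : forall A B : C, smc_hom A B -> Prop)
    : Prop := {
  wide_id : forall A, F _ _ (smc_id A);
  wide_comp : forall A B D (g : smc_hom B D) (f : smc_hom A B),
    F _ _ g -> F _ _ f -> F _ _ (g ∘ f);
  wide_tens : forall A B A' B' (f : smc_hom A B) (g : smc_hom A' B'),
    F _ _ f -> F _ _ g -> F _ _ (f ⊗ g);
  wide_assoc : forall A B D, F _ _ (smc_assoc A B D);
  wide_assocV : forall A B D, F _ _ (smc_assocV A B D);
  wide_lunit : forall A, F _ _ (smc_lunit A);
  wide_lunitV : forall A, F _ _ (smc_lunitV A);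
  wide_runit : forall A, F _ _ (smc_runit A);
  wide_runitV : forall A, F _ _ (smc_runitV A);
  wide_braid : forall A B, F _ _ (smc_braid A B)
}.

Record process_theory := ProcessTheory {
  pt_cat :> smc;
  free : forall A B : pt_cat, smc_hom A B -> Prop;
  freeP : is_wide_smsubcat free
}.
Arguments free {p A B} : rename.

Record mor (C : smc) := Mor {
  mor_dom : C;
  mor_cod : C;
  mor_hom : smc_hom mor_dom mor_cod
}.
Arguments Mor {C mor_dom mor_cod}.

HB.instance Definition _ (C : smc) := gen_eqMixin (mor C).
HB.instance Definition _ (C : smc) := gen_choiceMixin (mor C).

Definition mor_tens (C : smc) (f g : mor C) : mor C :=
  Mor (mor_hom f ⊗ mor_hom g).

Section Convertibility.
Variable T : process_theory.
Implicit Types f g h : mor T.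

(* f ⪰ g *)
Definition converts f g : Prop :=
  exists (Z E F : T)
         (xi1 : smc_hom (mor_dom g ⊠ E) (mor_dom f ⊠ Z))
         (xi2 : smc_hom (mor_cod f ⊠ Z) (mor_cod g ⊠ F))
         (j : smc_hom E F),
    [/\ free xi1, free xi2 &
        xi2 ∘ (mor_hom f ⊗ smc_id Z) ∘ xi1 = mor_hom g ⊗ j].

Let fP := freeP T.

Lemma converts_iso f g (a : smc_hom (mor_dom g) (mor_dom f))
    (b : smc_hom (mor_cod f) (mor_cod g)) :
  free a -> free b -> b ∘ mor_hom f ∘ a = mor_hom g -> converts f g.
Proof.
move=> fa fb e; exists smc_unit, smc_unit, smc_unit.
exists (a ⊗ smc_id _), (b ⊗ smc_id _), (smc_id _); split.
- by apply: wide_tens => //; apply: wide_id.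
- by apply: wide_tens => //; apply: wide_id.
- by rewrite -!smc_tens_comp e !smc_comp1f.
Qed.

Lemma converts_refl f : converts f f.
Proof.
apply: (@converts_iso _ _ (smc_id _) (smc_id _)); try exact: wide_id.
by rewrite smc_comp1f smc_compf1.
Qed.

Lemma smc_assocV_nat A B D A' B' D' (f : smc_hom A A') (g : smc_hom B B')
    (h : @smc_hom T D D') :
  smc_assocV A' B' D' ∘ (f ⊗ (g ⊗ h)) = ((f ⊗ g) ⊗ h) ∘ smc_assocV A B D.
Proof.
rewrite -[LHS]smc_compf1 -smc_assocVK smc_compA; congr (_ ∘ _).
by rewrite -smc_compA -smc_assoc_nat smc_compA smc_assocK smc_comp1f.
Qed.

(* A free natural isomorphism (A ⊠ B) ⊠ D -> (A ⊠ D) ⊠ B. *)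
Lemma swap_exists :
  exists swap : forall A B D : T, smc_hom ((A ⊠ B) ⊠ D) ((A ⊠ D) ⊠ B),
  [/\ forall A B D, free (swap A B D),
      forall A B D A' B' D' (f : smc_hom A A') (g : smc_hom B B')
        (h : smc_hom D D'),
        swap A' B' D' ∘ ((f ⊗ g) ⊗ h) = ((f ⊗ h) ⊗ g) ∘ swap A B D &
      forall A B D, swap A D B ∘ swap A B D = smc_id _].
Proof.
exists (fun A B D =>
  smc_assocV A D B ∘ (smc_id A ⊗ smc_braid B D) ∘ smc_assoc A B D).
split=> [A B D|A B D A' B' D' f g h|A B D].
- apply: (wide_comp fP); last exact: wide_assoc.
  apply: (wide_comp fP); first exact: wide_assocV.
  by apply: wide_tens => //; [apply: wide_id | apply: wide_braid].
- rewrite -smc_compA smc_assoc_nat !smc_compA; congr (_ ∘ _).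
  rewrite -smc_compA -smc_tens_comp smc_braid_nat smc_comp1f.
  rewrite -[in LHS](smc_compf1 f) smc_tens_comp smc_compA smc_assocV_nat.
  by rewrite -smc_compA.
- rewrite !smc_compA.
  rewrite -[X in X ∘ _ ∘ _]smc_compA smc_assocVK smc_compf1.
  rewrite -[X in X ∘ _]smc_compA -smc_tens_comp smc_braidK smc_comp1f.
  by rewrite smc_tens1 smc_compf1 smc_assocK.
Qed.

Lemma converts_trans f g h : converts f g -> converts g h -> converts f h.
Proof.
have [swap [fS swap_nat swapK]] := swap_exists.
case=> [Z [E [F [x1 [x2 [j [fx1 fx2 ex]]]]]]].
case=> [W [G [H [y1 [y2 [k [fy1 fy2 ey]]]]]]].
exists (Z ⊠ W), (G ⊠ E), (H ⊠ F).
exists (smc_assoc _ _ _ ∘ (x1 ⊗ smc_id W) ∘ swap _ _ _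
          ∘ (y1 ⊗ smc_id E) ∘ smc_assocV _ _ _).
exists (smc_assoc _ _ _ ∘ (y2 ⊗ smc_id F) ∘ swap _ _ _
          ∘ (x2 ⊗ smc_id W) ∘ smc_assocV _ _ _), (k ⊗ j).
have fI (A : T) : free (smc_id A) by apply: wide_id.
have fA A B D : free (@smc_assoc T A B D) by apply: wide_assoc.
have fV A B D : free (@smc_assocV T A B D) by apply: wide_assocV.
have fC := wide_comp fP; have fT := wide_tens fP.
split; try by auto 12.
rewrite -smc_tens1 !smc_compA -[_ ∘ smc_assocV _ _ _ ∘ _]smc_compA.
rewrite smc_assocV_nat.
rewrite !smc_compA -[_ ∘ smc_assocV _ _ _ ∘ _]smc_compA smc_assocK smc_compf1.
rewrite -[_ ∘ (x2 ⊗ _) ∘ _]smc_compA -smc_tens_comp.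
rewrite -[_ ∘ _ ∘ (x1 ⊗ _)]smc_compA -smc_tens_comp ex !smc_comp1f.
rewrite -[_ ∘ swap _ _ _ ∘ (_ ⊗ _ ⊗ _)]smc_compA swap_nat.
rewrite !smc_compA -[_ ∘ swap _ _ _ ∘ swap _ _ _]smc_compA swapK smc_compf1.
rewrite -[_ ∘ (y2 ⊗ _) ∘ _]smc_compA -smc_tens_comp.
rewrite -[_ ∘ _ ∘ (y1 ⊗ _)]smc_compA -smc_tens_comp ey smc_compf1 smc_comp1f.
by rewrite smc_assoc_nat -smc_compA smc_assocVK smc_compf1.
Qed.

Lemma converts_tensC f g : converts (mor_tens f g) (mor_tens g f).
Proof.
apply: (@converts_iso (mor_tens f g) (mor_tens g f)
  _ _ (wide_braid fP _ _) (wide_braid fP _ _)).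
by rewrite /= smc_braid_nat -smc_compA smc_braidK smc_compf1.
Qed.

Lemma converts_tensr f g h :
  converts f g -> converts (mor_tens f h) (mor_tens g h).
Proof.
have [swap [fS swap_nat swapK]] := swap_exists.
case=> [Z [E [F [x1 [x2 [j [fx1 fx2 ex]]]]]]].
exists Z, E, F, (swap _ _ _ ∘ (x1 ⊗ smc_id _) ∘ swap _ _ _).
exists (swap _ _ _ ∘ (x2 ⊗ smc_id _) ∘ swap _ _ _), j.
have fI (A : T) : free (smc_id A) by apply: wide_id.
have fC := wide_comp fP; have fT := wide_tens fP.
split; try by auto 12.
rewrite /= !smc_compA -[_ ∘ swap _ _ _ ∘ (_ ⊗ _ ⊗ _)]smc_compA swap_nat.
rewrite !smc_compA -[_ ∘ swap _ _ _ ∘ swap _ _ _]smc_compA swapK smc_compf1.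
rewrite -[_ ∘ (x2 ⊗ _) ∘ _]smc_compA -smc_tens_comp.
rewrite -[_ ∘ _ ∘ (x1 ⊗ _)]smc_compA -smc_tens_comp ex smc_compf1 smc_comp1f.
by rewrite swap_nat -smc_compA swapK smc_compf1.
Qed.

Lemma converts_tens f g f' g' : converts f g -> converts f' g' ->
  converts (mor_tens f f') (mor_tens g g').
Proof.
move=> fg fg'; apply: converts_trans (converts_tensr _ fg) _.
apply: converts_trans (converts_tensC _ _) _.
by apply: converts_trans (converts_tensr _ fg') (converts_tensC _ _).
Qed.

Lemma converts_tensA f g h :
  converts (mor_tens f (mor_tens g h)) (mor_tens (mor_tens f g) h).
Proof.
apply: (@converts_iso (mor_tens f (mor_tens g h)) (mor_tens (mor_tens f g) h)
  _ _ (wide_assoc fP _ _ _) (wide_assocV fP _ _ _)).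
by rewrite /= smc_assocV_nat -smc_compA smc_assocK smc_compf1.
Qed.

Lemma converts_tensAV f g h :
  converts (mor_tens (mor_tens f g) h) (mor_tens f (mor_tens g h)).
Proof.
apply: (@converts_iso (mor_tens (mor_tens f g) h) (mor_tens f (mor_tens g h))
  _ _ (wide_assocV fP _ _ _) (wide_assoc fP _ _ _)).
by rewrite /= smc_assoc_nat -smc_compA smc_assocVK smc_compf1.
Qed.

Lemma converts_tens1 f : converts (mor_tens f (Mor (smc_id smc_unit))) f.
Proof.
apply: (@converts_iso (mor_tens f (Mor (smc_id smc_unit))) f
  _ _ (wide_runitV fP _) (wide_runit fP _)).
by rewrite /= smc_runit_nat -smc_compA smc_runitVK smc_compf1.
Qed.

Lemma converts_tens1V f : converts f (mor_tens f (Mor (smc_id smc_unit))).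
Proof.
apply: (@converts_iso f (mor_tens f (Mor (smc_id smc_unit)))
  _ _ (wide_runit fP _) (wide_runitV fP _)).
by rewrite /= -smc_compA -smc_runit_nat smc_compA smc_runitK smc_comp1f.
Qed.

Lemma converts_id (A B : T) : converts (Mor (smc_id A)) (Mor (smc_id B)).
Proof.
exists B, A, A, (smc_braid _ _), (smc_braid _ _), (smc_id _).
split; try exact: wide_braid.
by rewrite /= !smc_tens1 smc_compf1 smc_braidK.
Qed.

Definition interconvertible : rel (mor T) :=
  fun f g => `[< converts f g /\ converts g f >].

Lemma interconvertible_refl : reflexive interconvertible.
Proof. by move=> f; apply/asboolP; split; apply: converts_refl. Qed.

Lemma interconvertible_sym : symmetric interconvertible.
Proof. by move=> f g; apply/asboolP/asboolP => -[]. Qed.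

Lemma interconvertible_trans : transitive interconvertible.
Proof.
move=> g f h /asboolP[fg gf] /asboolP[gh hg]; apply/asboolP.
by split; [apply: converts_trans fg gh | apply: converts_trans hg gf].
Qed.

Canonical interconvertible_equiv := EquivRel interconvertible
  interconvertible_refl interconvertible_sym interconvertible_trans.

(* |PCD(C, C_free)|; the class [f] is \pi_PCD f. *)
Definition PCD := {eq_quot interconvertible}%qT.

HB.instance Definition _ := Choice.on PCD.
HB.instance Definition _ := EqQuotient.on PCD.

Local Open Scope quotient_scope.

Lemma pi_PCDP f g : reflect (converts f g /\ converts g f)
  (\pi_PCD f == \pi_PCD g).
Proof.
by apply: (iffP idP) => [/eqP/eqmodP/asboolP|?]; last exact/eqP/eqmodP/asboolP.
Qed.

Lemma repr_PCD f : converts (repr (\pi_PCD f)) f /\ converts f (repr (\pi_PCD f)).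
Proof. by apply/pi_PCDP; rewrite reprK. Qed.

(* x <= y iff y ⪰ x *)
Definition PCD_le (x y : PCD) : bool := `[< converts (repr y) (repr x) >].
Definition PCD_mul (x y : PCD) : PCD := \pi_PCD (mor_tens (repr x) (repr y)).
Definition PCD_one : PCD := \pi_PCD (Mor (smc_id (smc_unit : T))).

Lemma PCD_leP f g : reflect (converts f g) (PCD_le (\pi_PCD g) (\pi_PCD f)).
Proof.
have [fr rf] := repr_PCD f; have [gr rg] := repr_PCD g.
apply: (iffP (asboolP _)) => h.
  exact: converts_trans rf (converts_trans h gr).
exact: converts_trans fr (converts_trans h rg).
Qed.

Lemma PCD_mulE f g : PCD_mul (\pi_PCD f) (\pi_PCD g) = \pi_PCD (mor_tens f g).
Proof.
have [fr rf] := repr_PCD f; have [gr rg] := repr_PCD g.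
by apply/eqP/pi_PCDP; split; apply: converts_tens.
Qed.

Lemma PCD_oneE (Z : T) : \pi_PCD (Mor (smc_id Z)) = PCD_one.
Proof. by apply/eqP/pi_PCDP; split; apply: converts_id. Qed.

Lemma PCD_le_refl : reflexive PCD_le.
Proof. by move=> x; apply/asboolP/converts_refl. Qed.

Lemma PCD_le_anti : antisymmetric PCD_le.
Proof.
move=> x y; rewrite -[x]reprK -[y]reprK => /andP[/PCD_leP xy /PCD_leP yx].
by apply/eqP/pi_PCDP.
Qed.

Lemma PCD_le_trans : transitive PCD_le.
Proof.
move=> y x z /asboolP xy /asboolP yz; apply/asboolP.
exact: converts_trans yz xy.
Qed.

Lemma PCD_mulC : commutative PCD_mul.
Proof.
move=> x y; rewrite -[x]reprK -[y]reprK !PCD_mulE.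
by apply/eqP/pi_PCDP; split; apply: converts_tensC.
Qed.

Lemma PCD_mulA : associative PCD_mul.
Proof.
move=> x y z; rewrite -[x]reprK -[y]reprK -[z]reprK.
rewrite (PCD_mulE (repr y)) (PCD_mulE (repr x) (repr y)) !PCD_mulE.
by apply/eqP/pi_PCDP; split; [apply: converts_tensA | apply: converts_tensAV].
Qed.

Lemma PCD_mulx1 : right_id PCD_one PCD_mul.
Proof.
move=> x; rewrite -[x]reprK PCD_mulE.
by apply/eqP/pi_PCDP; split; [apply: converts_tens1 | apply: converts_tens1V].
Qed.

Lemma PCD_mul1x : left_id PCD_one PCD_mul.
Proof. by move=> x; rewrite PCD_mulC PCD_mulx1. Qed.

Lemma PCD_leM x y z w : PCD_le y x -> PCD_le w z ->
  PCD_le (PCD_mul y w) (PCD_mul x z).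
Proof. by move=> /asboolP ? /asboolP ?; apply/PCD_leP/converts_tens. Qed.

End Convertibility.

Arguments PCD T : clear implicits.

HB.mixin Record POrderedMonoid_isOrdered d (X : Type)
    of Order.POrder d X & Monoid X := {
  omul_ge : forall x y z w : X,
    (x >= y)%O -> (z >= w)%O -> (x * z >= y * w :> X)%g%O
}.

#[short(type="orderedMonoidType")]
HB.structure Definition OrderedMonoid d :=
  { X of Order.POrder d X & Monoid X & POrderedMonoid_isOrdered d X }.

Definition nonnegative d (X : orderedMonoidType d) : Prop :=
  forall x : X, (x >= 1%g)%O.

Definition ordered_monoid_hom d d' (X : orderedMonoidType d)
    (Y : orderedMonoidType d') (M : X -> Y) : Prop :=
  {homo M : x y / (x >= y)%O} /\ monoid_morphism M.

Fact PCD_display : Order.disp_t. Proof. exact: Order.Disp tt tt. Qed.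

HB.instance Definition _ (T : process_theory) :=
  Order.Le_isPOrder.Build PCD_display (PCD T)
    (@PCD_le_refl T) (@PCD_le_anti T) (@PCD_le_trans T).

HB.instance Definition _ (T : process_theory) :=
  isMonoid.Build (PCD T) (@PCD_mulA T) (@PCD_mul1x T) (@PCD_mulx1 T).

HB.instance Definition _ (T : process_theory) :=
  POrderedMonoid_isOrdered.Build PCD_display (PCD T) (@PCD_leM T).

Definition PCD_valuation (T : process_theory) d (X : orderedMonoidType d)
    (mu : mor T -> X) : Prop :=
  [/\ forall f g : mor T, mu (mor_tens f g) = (mu f * mu g)%g,
      forall Z : T, mu (Mor (smc_id Z)) = 1%g,
      forall (A B D : T) (f : smc_hom A B) (xi : smc_hom B D),
        free xi -> (mu (Mor f) >= mu (Mor (xi ∘ f)))%O &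
      forall (A B D : T) (f : smc_hom B D) (xi : smc_hom A B),
        free xi -> (mu (Mor f) >= mu (Mor (f ∘ xi)))%O].

Definition induces (T : process_theory) d (X : orderedMonoidType d)
    (mu : mor T -> X) (M : PCD T -> X) : Prop :=
  forall f : mor T, M (\pi_(PCD T) f)%qT = mu f.

(* Main.v *)
(* Composing with a free morphism is a special case of conversion, so a monotone
   homomorphism satisfies (iii). Conversely, if xi2 ∘ (f ⊗ 1_Z) ∘ xi1 = g ⊗ j,
   then mu f = mu (f ⊗ 1_Z) >= mu (g ⊗ j) = mu g * mu j >= mu g, the last step
   because mu j >= 1. *)
Require Import Defs.
From mathcomp Require Import all_boot all_order.
From mathcomp Require Import boolp.

Set Implicit Arguments.
Unset Strict Implicit.

Import Order.Theory.
Local Open Scope smc_scope.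

Lemma converts_compl (T : process_theory) (A B D : T) (f : smc_hom A B)
    (xi : smc_hom B D) :
  free xi -> converts (Mor f) (Mor (xi ∘ f)).
Proof.
move=> fxi; apply: (@converts_iso _ (Mor f) (Mor (xi ∘ f)) (smc_id A) xi) => //.
  exact: wide_id (freeP T) _.
by rewrite /= smc_compf1.
Qed.

Lemma converts_compr (T : process_theory) (A B D : T) (f : smc_hom B D)
    (xi : smc_hom A B) :
  free xi -> converts (Mor f) (Mor (f ∘ xi)).
Proof.
move=> fxi; apply: (@converts_iso _ (Mor f) (Mor (f ∘ xi)) xi (smc_id D)) => //.
  exact: wide_id (freeP T) _.
by rewrite /= smc_comp1f.
Qed.

(** Applied in both directions to interconvertible morphisms, this bound forces equal values by
    antisymmetry, so [mu] descends to classes. *)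
Lemma valuation_converts (T : process_theory) d (X : orderedMonoidType d)
    (mu : mor T -> X) :
  nonnegative X -> PCD_valuation mu ->
  forall f g, converts f g -> (mu g <= mu f)%O.
Proof.
move=> X_ge1 [muM mu1 mul mur] f g [Z [E [F [xi1 [xi2 [j [fxi1 fxi2 e]]]]]]].
have le_tens : (mu g <= mu (mor_tens g (Mor j)))%O.
  by rewrite muM -[leLHS]mulg1; apply: omul_ge.
(* By [e], the tensor [g ⊗ j] becomes a composite associated to the left, so [xi1] is stripped
   before [xi2]. *)
apply: (le_trans le_tens); rewrite /mor_tens /= -e.
apply: (le_trans (mur _ _ _ _ _ fxi1)); apply: (le_trans (mul _ _ _ _ _ fxi2)).
by rewrite (muM f (Mor (smc_id Z))) mu1 mulg1.
Qed.

Lemma induced_hom (T : process_theory) d (X : orderedMonoidType d)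
    (mu : mor T -> X) :
  nonnegative X -> PCD_valuation mu ->
  exists M : PCD T -> X, ordered_monoid_hom M /\ induces mu M.
Proof.
move=> X_ge1 muP; have mu_le := valuation_converts X_ge1 muP.
have [muM mu1 _ _] := muP.
(* The order and product of [PCD T] are themselves defined through [repr], so with this choice the
   homomorphism laws reduce to facts about [mu] on representatives. *)
pose M (x : PCD T) := mu (repr x).
have Mpi : induces mu M.
  by move=> f; have [fr rf] := repr_PCD f; apply/le_anti; rewrite !mu_le.
exists M; split=> //; split; first by move=> x y /asboolP /mu_le.
split; first by rewrite -(mu1 smc_unit); apply: Mpi.
by move=> x y; rewrite /M -muM; apply: Mpi.
Qed.

(** Since [mu] is [M] after the quotient map, each condition is checked on classes. *)
Lemma induced_valuation (T : process_theory) d (X : orderedMonoidType d)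
    (mu : mor T -> X) (M : PCD T -> X) :
  ordered_monoid_hom M -> induces mu M -> PCD_valuation mu.
Proof.
move=> [Mle [M1 MM]] Mmu; split=> [f g|Z|A B D f xi fxi|A B D f xi fxi].
- by rewrite -!Mmu -MM; congr M; rewrite -PCD_mulE.
(* The braiding converts any identity into any other, so all of them lie in the unit class. *)
- by rewrite -Mmu PCD_oneE.
- by rewrite -!Mmu; apply/Mle/PCD_leP/converts_compl.
- by rewrite -!Mmu; apply/Mle/PCD_leP/converts_compr.
Qed.

Theorem theorem3p4 (T : process_theory) (d : Order.disp_t)
  (X : orderedMonoidType d) (X_nonneg : nonnegative X) :
  (forall mu : mor T -> X,
     (exists M : PCD T -> X, ordered_monoid_hom M /\ induces mu M)
     <-> PCD_valuation mu)
  /\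
  (* the correspondence mu <-> M is one-to-one *)
  ((forall mu : mor T -> X, PCD_valuation mu ->
      exists! M : PCD T -> X, ordered_monoid_hom M /\ induces mu M)
   /\
   (forall M : PCD T -> X, ordered_monoid_hom M ->
      exists! mu : mor T -> X, PCD_valuation mu /\ induces mu M)).
Proof.
split; [|split].
- move=> mu; split; last exact: induced_hom.
  by case=> M [Mhom Mmu]; apply: induced_valuation Mhom Mmu.
- move=> mu muP; have [M [Mhom Mmu]] := induced_hom X_nonneg muP.
  (* Uniqueness of [M] is surjectivity of the quotient map. *)
  exists M; split=> // M' [_ M'mu]; apply/funext => x.
  by rewrite -[x]reprK Mmu M'mu.
(* The equation [induces mu M] leaves only this candidate for [mu]. *)
- move=> M Mhom; exists (fun f => M (\pi_(PCD T) f)%qT); split.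
    by split=> //; apply: induced_valuation Mhom _.
  by move=> mu [_ Mmu]; apply/funext => f; rewrite Mmu.
Qed.
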